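(* Fix $0<\delta<1$. Consider positive integers $K,N,s$ with $M=Ks\ge N\ge s$, and let $$R_1=2s\,e^{(1+\delta)s/2-s(s-1)(\delta^2/2-\delta^3/3)/2},$$ $$R_2=2\left(M+K\left(1+\frac4\delta\right)^s\right)e^{-N\delta^2/4+N\delta^3/3}+2\left(1+\frac4\delta\right)^N e^{-M\delta^2/4+M\delta^3/3}.$$ If $N,s\to\infty$ with $s/N\to c>0$, and $K$ is such that $$\frac{3\ln(K+1)}{N}+\frac sN\ln\left(1+\frac4\delta\right)<\frac{\delta^2}{4}-\frac{\delta^3}{3}$$ and $$\frac{N}{Ks}\ln\left(1+\frac4\delta\right)<\frac{\delta^2}{4}-\frac{\delta^3}{3},$$ then $R_1+R_2$ decays exponentially in $N$.
   Context: The statement concerns sequences of triples $(K,N,s)$ along which $N,s\to\infty$; a quantity decays exponentially in $N$ if it is bounded by $Ce^{-\gamma N}$ for some constants $C,\gamma>0$ along the sequence.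
   Formalization: The two strict inequalities on K are required to hold with a gap that does not close along the sequence (limsup of each left side is below δ²/4−δ³/3); with mere term-by-term strict inequality the last summand of R_2 need not tend to zero. *)

(* Defs.v *)
From Stdlib Require Import Reals.
From Coquelicot Require Import Coquelicot.
Open Scope R_scope.

(* Named with an underscore because [R1] is the real number one in Stdlib. *)
Definition R_1 (delta : R) (s : nat) : R :=
  2 * INR s *
  exp ((1 + delta) * INR s / 2
       - INR s * (INR s - 1) * (delta ^ 2 / 2 - delta ^ 3 / 3) / 2).

Definition R_2 (delta : R) (K N s : nat) : R :=
  let M := (K * s)%nat in
  2 * (INR M + INR K * (1 + 4 / delta) ^ s)
    * exp (- (INR N * delta ^ 2 / 4) + INR N * delta ^ 3 / 3)
  + 2 * (1 + 4 / delta) ^ N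
    * exp (- (INR M * delta ^ 2 / 4) + INR M * delta ^ 3 / 3).

Definition decays_exponentially_in (N : nat -> nat) (x : nat -> R) : Prop :=
  exists C gamma : R, 0 < C /\ 0 < gamma /\
    forall n : nat, Rabs (x n) <= C * exp (- gamma * INR (N n)).

(* A strict inequality [u < b] in the asymptotic regime: the gap does not
   close along the sequence.  If it held only term by term, the exponents in
   [R_2] could stay bounded and [R_2] would not even tend to zero. *)
Definition asymptotically_lt (u : nat -> R) (b : R) : Prop :=
  Rbar_lt (LimSup_seq u) (Finite b).

(* Main.v *)
Require Import Defs.
From Stdlib Require Import Reals.
From Coquelicot Require Import Coquelicot.
From Stdlib Require Import Lra Lia.
Open Scope R_scope.

(** Write [a = delta^2/4 - delta^3/3], [b = delta^2/2 - delta^3/3] and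
    [L = ln (1 + 4/delta)], so that [(1 + 4/delta)^m = exp (m L)].  The sum
    splits into four terms, and each is an exponential whose exponent is
    eventually at most a negative multiple of [N], up to a polynomial factor.

    In [R_1] the exponent is quadratic in [s] with leading coefficient
    [- b/2 < 0], so [R_1] is eventually below [2 exp (- s)], and [s] is of
    order at least [N] because [s/N] has a positive limit ([R_1_decays]).

    In [R_2] the strict inequalities leave gaps [e1, e2 > 0]: eventually
    [3 ln (K+1) + s L <= (a - e1) N] and [N L <= (a - e2) M], where [M = K s].
    The first makes [K exp (s L - a N)] at most [exp (- e1 N)], and makes
    [M exp (- a N)], where [M <= (K+1) N], at most [N exp (- e1 N)]; the
    second makes [exp (N L - a M)] at most [exp (- e2 M)], which is at most
    [exp (- e2 N)] since [N <= M] ([R_2_first_decays], [R_2_second_decays],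
    [R_2_third_decays]).

    Exponential decay asks for a bound at every index, but finitely many
    indices only affect the constant ([decays_of_eventually]). *)

(** * Estimates on the exponential *)

Lemma exp_le_compat (x y : R) : x <= y -> exp x <= exp y.
Proof.
  intros [H| ->]; [left; now apply exp_increasing | apply Rle_refl].
Qed.

Lemma pow_exp_ln (x : R) (n : nat) : 0 < x -> x ^ n = exp (INR n * ln x).
Proof. intros Hx; now rewrite <- (Rpower_pow n x Hx). Qed.

Lemma linear_le_exp (t x : R) : 0 < t -> x <= / t * exp (t * x).
Proof.
  intros Ht.
  apply (Rmult_le_reg_l t); [exact Ht|].
  rewrite <- Rmult_assoc, Rinv_r, Rmult_1_l by lra.
  pose proof (exp_ineq1_le (t * x)); lra.
Qed.

(** * Exponential decay along a sequence *)

(** The finitely many indices outside the eventual regime are absorbed one at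
    a time: [Rabs (x n) * exp (gamma * N n)] is added to the constant. *)
Lemma decays_of_eventually (N : nat -> nat) (x : nat -> R) (C gamma : R) :
  0 < C -> 0 < gamma ->
  eventually (fun n => Rabs (x n) <= C * exp (- gamma * INR (N n))) ->
  decays_exponentially_in N x.
Proof.
  intros HC Hg [n0 H].
  revert C HC H; induction n0 as [|n0 IH]; intros C HC H.
  { exists C, gamma; repeat split; auto with arith. }
  set (C0 := Rabs (x n0) * exp (gamma * INR (N n0))).
  assert (HC0 : 0 <= C0).
  { apply Rmult_le_pos; [apply Rabs_pos | left; apply exp_pos]. }
  apply (IH (C + C0)); [lra|].
  intros n Hn.
  pose proof (exp_pos (- gamma * INR (N n))) as He.
  destruct (Nat.eq_dec n n0) as [->|Hne].
  - replace (Rabs (x n0)) with (C0 * exp (- gamma * INR (N n0))).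
    + nra.
    + unfold C0; rewrite Rmult_assoc, <- exp_plus.
      replace (gamma * INR (N n0) + - gamma * INR (N n0)) with 0 by ring.
      rewrite exp_0; ring.
  - assert (Hb := H n ltac:(lia)); nra.
Qed.

Lemma decays_plus (N : nat -> nat) (x y : nat -> R) :
  decays_exponentially_in N x -> decays_exponentially_in N y ->
  decays_exponentially_in N (fun n => x n + y n).
Proof.
  intros (C & g & HC & Hg & Hx) (D & h & HD & Hh & Hy).
  exists (C + D), (Rmin g h).
  split; [lra|]; split; [now apply Rmin_pos|]; intros n.
  assert (HN := pos_INR (N n)).
  assert (Eg : exp (- g * INR (N n)) <= exp (- Rmin g h * INR (N n))).
  { apply exp_le_compat; pose proof (Rmin_l g h); nra. }
  assert (Eh : exp (- h * INR (N n)) <= exp (- Rmin g h * INR (N n))).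
  { apply exp_le_compat; pose proof (Rmin_r g h); nra. }
  specialize (Hx n); specialize (Hy n).
  pose proof (Rabs_triang (x n) (y n)); nra.
Qed.

(** A finite limsup [l] leaves half of [b - l] as a gap; a limsup equal to
    minus infinity leaves any gap, and [1] is taken. *)
Lemma asymptotically_lt_gap (u : nat -> R) (b : R) :
  asymptotically_lt u b ->
  exists e, 0 < e /\ eventually (fun n => u n <= b - e).
Proof.
  unfold asymptotically_lt, LimSup_seq.
  destruct (ex_LimSup_seq u) as [[l| |] Hl]; simpl; intros Hlt.
  - assert (He : 0 < (b - l) / 2) by lra.
    destruct (Hl (mkposreal _ He)) as [_ [n0 Hn0]]; simpl in Hn0.
    exists ((b - l) / 2); split; [exact He|].
    exists n0; intros n Hn; specialize (Hn0 n Hn); lra.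
  - contradiction.
  - destruct (Hl (b - 1)) as [n0 Hn0].
    exists 1; split; [lra|].
    exists n0; intros n Hn; left; auto.
Qed.

(** * The four terms *)

Lemma R_1_decays (delta : R) (N s : nat -> nat) (c : R) :
  0 < delta < 1 -> 0 < c ->
  (forall n, (0 < N n)%nat) ->
  is_lim_seq (fun n => INR (s n)) p_infty ->
  is_lim_seq (fun n => INR (s n) / INR (N n)) (Finite c) ->
  decays_exponentially_in N (fun n => R_1 delta (s n)).
Proof.
  intros Hd Hc HN Hs Hr.
  set (b := delta ^ 2 / 2 - delta ^ 3 / 3).
  assert (Hb : 0 < b).
  { unfold b. replace (delta ^ 2 / 2 - delta ^ 3 / 3)
      with (delta * delta * (1 / 2 - delta / 3)) by field.
    apply Rmult_lt_0_compat; nra. }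
  apply is_lim_seq_spec in Hr; apply is_lim_seq_spec in Hs.
  assert (Hc2 : 0 < c / 2) by lra.
  specialize (Hr (mkposreal _ Hc2)).
  (* [6 / b] makes the quadratic term at least [3 s]: one [s] for the factor
     [s <= exp s], one for [(1 + delta) s / 2 <= s], one for the decay. *)
  specialize (Hs (1 + 6 / b)).
  apply (decays_of_eventually N _ 2 (c / 2)); [lra | lra |].
  generalize (filter_and _ _ Hr Hs); apply filter_imp; clear Hr Hs.
  simpl; intros n [Hr Hs].
  assert (HNn : 0 < INR (N n)) by now apply lt_0_INR.
  set (x := INR (s n)) in *.
  assert (Hx : c / 2 * INR (N n) <= x).
  { apply Rabs_def2 in Hr.
    replace x with (x / INR (N n) * INR (N n)) by (field; lra).
    apply Rmult_le_compat_r; lra. }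
  assert (H6 : 6 <= (x - 1) * b).
  { replace 6 with (6 / b * b) by (field; lra).
    apply Rmult_le_compat_r; lra. }
  assert (Hx0 : 0 <= x) by apply pos_INR.
  unfold R_1; fold x b.
  rewrite Rabs_pos_eq.
  2: { apply Rmult_le_pos; [lra | left; apply exp_pos]. }
  apply Rle_trans with
    (2 * exp x * exp ((1 + delta) * x / 2 - x * (x - 1) * b / 2)).
  - apply Rmult_le_compat_r; [left; apply exp_pos|].
    pose proof (exp_ineq1_le x); lra.
  - rewrite Rmult_assoc, <- exp_plus.
    apply Rmult_le_compat_l; [lra|]; apply exp_le_compat; nra.
Qed.

(** Multiplied by [N], the first condition bounds the exponent of
    [(K+1) exp (s L - a N)], the quantity that controls the first two terms
    of [R_2]; [3 ln (K+1)] dominates [ln (K+1)] because [K+1 >= 1]. *)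
Lemma first_condition_gap (K N s : nat -> nat) (a L : R) :
  (forall n, (0 < N n)%nat) ->
  asymptotically_lt
    (fun n => 3 * ln (INR (K n) + 1) / INR (N n)
              + INR (s n) / INR (N n) * L) a ->
  exists e, 0 < e /\
    eventually (fun n => ln (INR (K n) + 1) + INR (s n) * L - a * INR (N n)
                         <= - e * INR (N n)).
Proof.
  intros hN H; destruct (asymptotically_lt_gap _ _ H) as (e & He & Hev).
  exists e; split; [exact He|].
  revert Hev; apply filter_imp; intros n Hn.
  assert (HNn : 0 < INR (N n)) by now apply lt_0_INR.
  assert (Hln : 0 <= ln (INR (K n) + 1)).
  { rewrite <- ln_1; apply ln_le; [lra | pose proof (pos_INR (K n)); lra]. }
  apply (Rmult_le_compat_r (INR (N n))) in Hn; [|lra].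
  replace ((3 * ln (INR (K n) + 1) / INR (N n) + INR (s n) / INR (N n) * L)
           * INR (N n))
    with (3 * ln (INR (K n) + 1) + INR (s n) * L) in Hn by (field; lra).
  lra.
Qed.

(** Half of the gap pays for the polynomial factor [N] in [M <= (K+1) N]. *)
Lemma R_2_first_decays (K N s : nat -> nat) (a L e : R) :
  0 <= L -> 0 < e -> (forall n, (s n <= N n)%nat) ->
  eventually (fun n => ln (INR (K n) + 1) + INR (s n) * L - a * INR (N n)
                       <= - e * INR (N n)) ->
  decays_exponentially_in N
    (fun n => 2 * (INR (K n) * INR (s n)) * exp (- a * INR (N n))).
Proof.
  intros hL He Hs Hev.
  apply (decays_of_eventually N _ (2 * / (e / 2)) (e / 2)).
  - apply Rmult_lt_0_compat; [lra | apply Rinv_0_lt_compat; lra].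
  - lra.
  - revert Hev; apply filter_imp; intros n Hn.
    assert (HK := pos_INR (K n)); assert (Hs0 := pos_INR (s n)).
    assert (HsN := le_INR _ _ (Hs n)).
    assert (Hexp : INR (K n) + 1 = exp (ln (INR (K n) + 1)))
      by (rewrite exp_ln; lra).
    rewrite Rabs_pos_eq.
    2: { apply Rmult_le_pos; [nra | left; apply exp_pos]. }
    apply Rle_trans with
      (2 * (exp (ln (INR (K n) + 1)) * INR (N n)) * exp (- a * INR (N n))).
    { apply Rmult_le_compat_r; [left; apply exp_pos|].
      rewrite <- Hexp; nra. }
    apply Rle_trans with
      (2 * INR (N n) * exp (- e * INR (N n))).
    { replace (2 * (exp (ln (INR (K n) + 1)) * INR (N n))
               * exp (- a * INR (N n)))
        with (2 * INR (N n) *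
              (exp (ln (INR (K n) + 1)) * exp (- a * INR (N n)))) by ring.
      rewrite <- exp_plus.
      apply Rmult_le_compat_l; [lra|]; apply exp_le_compat; nra. }
    replace (- e * INR (N n))
      with (- (e / 2) * INR (N n) + - (e / 2 * INR (N n))) by field.
    rewrite exp_plus, exp_Ropp.
    pose proof (linear_le_exp (e / 2) (INR (N n)) ltac:(lra)) as Hlin.
    pose proof (exp_pos (e / 2 * INR (N n))) as Hp.
    apply (Rmult_le_compat_r (/ exp (e / 2 * INR (N n)))) in Hlin.
    2: { left; now apply Rinv_0_lt_compat. }
    rewrite Rmult_assoc, Rinv_r, Rmult_1_r in Hlin by lra.
    pose proof (exp_pos (- (e / 2) * INR (N n))); nra.
Qed.

Lemma R_2_second_decays (K N s : nat -> nat) (a L e : R) :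
  0 < e ->
  eventually (fun n => ln (INR (K n) + 1) + INR (s n) * L - a * INR (N n)
                       <= - e * INR (N n)) ->
  decays_exponentially_in N
    (fun n => 2 * (INR (K n) * exp (INR (s n) * L)) * exp (- a * INR (N n))).
Proof.
  intros He Hev.
  apply (decays_of_eventually N _ 2 e); [lra | lra |].
  revert Hev; apply filter_imp; intros n Hn.
  assert (HK := pos_INR (K n)).
  assert (Hexp : INR (K n) + 1 = exp (ln (INR (K n) + 1)))
    by (rewrite exp_ln; lra).
  pose proof (exp_pos (INR (s n) * L)) as Hp.
  pose proof (exp_pos (- a * INR (N n))) as Hq.
  rewrite Rabs_pos_eq by (apply Rmult_le_pos; nra).
  apply Rle_trans with
    (2 * (exp (ln (INR (K n) + 1)) * exp (INR (s n) * L)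
          * exp (- a * INR (N n)))).
  - rewrite <- Hexp; nra.
  - rewrite <- !exp_plus.
    apply Rmult_le_compat_l; [lra|]; apply exp_le_compat; lra.
Qed.

(** The second condition gives decay in [M = K s], hence in [N <= M]. *)
Lemma R_2_third_decays (K N s : nat -> nat) (a L : R) :
  (forall n, (0 < N n)%nat) ->
  (forall n, (N n <= K n * s n)%nat) ->
  asymptotically_lt
    (fun n => INR (N n) / (INR (K n) * INR (s n)) * L) a ->
  decays_exponentially_in N
    (fun n => 2 * exp (INR (N n) * L) * exp (- a * (INR (K n) * INR (s n)))).
Proof.
  intros hN HM H; destruct (asymptotically_lt_gap _ _ H) as (e & He & Hev).
  apply (decays_of_eventually N _ 2 e); [lra | lra |].
  revert Hev; apply filter_imp; intros n Hn.
  assert (HNn : 0 < INR (N n)) by now apply lt_0_INR.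
  assert (HMn := le_INR _ _ (HM n)); rewrite mult_INR in HMn.
  set (M := INR (K n) * INR (s n)) in *.
  apply (Rmult_le_compat_r M) in Hn; [|lra].
  replace (INR (N n) / M * L * M) with (INR (N n) * L) in Hn by (field; lra).
  rewrite Rabs_pos_eq.
  2: { apply Rmult_le_pos; [|left; apply exp_pos].
       pose proof (exp_pos (INR (N n) * L)); lra. }
  rewrite Rmult_assoc, <- exp_plus.
  apply Rmult_le_compat_l; [lra|]; apply exp_le_compat; nra.
Qed.

Lemma R_2_split (delta : R) (K N s : nat) :
  0 < delta ->
  let a := delta ^ 2 / 4 - delta ^ 3 / 3 in
  let L := ln (1 + 4 / delta) in
  R_2 delta K N s =
    2 * (INR K * INR s) * exp (- a * INR N)
    + 2 * (INR K * exp (INR s * L)) * exp (- a * INR N)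
    + 2 * exp (INR N * L) * exp (- a * (INR K * INR s)).
Proof.
  intros Hd a L; unfold R_2.
  assert (0 < 1 + 4 / delta).
  { assert (0 < 4 / delta) by (apply Rdiv_lt_0_compat; lra); lra. }
  rewrite !(pow_exp_ln (1 + 4 / delta)), mult_INR by assumption; fold L.
  replace (- (INR N * delta ^ 2 / 4) + INR N * delta ^ 3 / 3)
    with (- a * INR N) by (unfold a; field).
  replace (- (INR K * INR s * delta ^ 2 / 4) + INR K * INR s * delta ^ 3 / 3)
    with (- a * (INR K * INR s)) by (unfold a; field).
  ring.
Qed.

Theorem corollary4p6 :
  forall (delta : R) (hdelta : 0 < delta < 1)
    (K N s : nat -> nat)
    (hK : forall n, (0 < K n)%nat)
    (hN : forall n, (0 < N n)%nat)
    (hs : forall n, (0 < s n)%nat)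
    (hsN : forall n, (s n <= N n)%nat)
    (hNM : forall n, (N n <= K n * s n)%nat)
    (hNlim : is_lim_seq (fun n => INR (N n)) p_infty)
    (hslim : is_lim_seq (fun n => INR (s n)) p_infty)
    (c : R) (hc : 0 < c)
    (hratio : is_lim_seq (fun n => INR (s n) / INR (N n)) (Finite c))
    (hcond1 : asymptotically_lt
       (fun n => 3 * ln (INR (K n) + 1) / INR (N n)
                 + INR (s n) / INR (N n) * ln (1 + 4 / delta))
       (delta ^ 2 / 4 - delta ^ 3 / 3))
    (hcond2 : asymptotically_lt
       (fun n => INR (N n) / (INR (K n) * INR (s n)) * ln (1 + 4 / delta))
       (delta ^ 2 / 4 - delta ^ 3 / 3)),
    decays_exponentially_in N
      (fun n => R_1 delta (s n) + R_2 delta (K n) (N n) (s n)).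
Proof.
  intros delta hdelta K N s hK hN hs hsN hNM hNlim hslim c hc hratio
    hcond1 hcond2.
  assert (hL : 0 <= ln (1 + 4 / delta)).
  { assert (0 < 4 / delta) by (apply Rdiv_lt_0_compat; lra).
    rewrite <- ln_1; apply ln_le; lra. }
  destruct (first_condition_gap K N s _ _ hN hcond1) as (e & He & Hev).
  apply decays_plus; [now apply (R_1_decays delta N s c)|].
  pose proof (R_2_first_decays K N s _ _ e hL He hsN Hev) as H1.
  pose proof (R_2_second_decays K N s _ _ e He Hev) as H2.
  pose proof (R_2_third_decays K N s _ _ hN hNM hcond2) as H3.
  destruct (decays_plus _ _ _ (decays_plus _ _ _ H1 H2) H3)
    as (C & g & HC & Hg & H).
  exists C, g; split; [exact HC|]; split; [exact Hg|]; intros n.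
  rewrite R_2_split by lra; apply H.
Qed.
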